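(* Let $K_1,K_2,\ldots$ and $K$ be non-empty compact subsets of $\ell^2$. Then $[K_n]\to[K]$ in $(\mathbb{H},d_\sim)$ as $n\to\infty$ if and only if $K_n\to K$ in the Gromov-Hausdorff sense as $n\to\infty$ (i.e. $d_{GH}(K_n,K)\to0$), where $K_n$ and $K$ are regarded as metric spaces with the metric induced from $\ell^2$.
   Context: $\ell^2$ is the real Hilbert space of square summable sequences. $\mathcal{K}(\ell^2)$ is the set of non-empty compact subsets of $\ell^2$ and $d_H$ is the Hausdorff distance on it. For $K_1,K_2\in\mathcal{K}(\ell^2)$ write $K_1\sim K_2$ if there is a distance-preserving bijection $J:K_1\to K_2$ ($J$ need not be defined outside $K_1$). $[K]$ is the equivalence class of $K$, and $\mathbb{H}:=\mathcal{K}(\ell^2)/\sim$. The Hausdorff distance up to isometry is $d_\sim([K_1],[K_2])=\inf_{K_1'\in[K_1],\,K_2'\in[K_2]}d_H(K_1',K_2')$, which is a metric on $\mathbb{H}$. The Gromov-Hausdorff distance $d_{GH}(E_1,E_2)$ between compact metric spaces is the infimum of $d_H(\varphi_1(E_1),\varphi_2(E_2))$ over all metric spaces $M$ and all isometric embeddings $\varphi_1:E_1\to M$, $\varphi_2:E_2\to M$, with $d_H$ here the Hausdorff distance in $M$. *)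

(* Defs.v *)
From HB Require Import structures.
From mathcomp Require Import all_boot all_order all_algebra generic_quotient.
From mathcomp Require Import all_classical all_reals all_analysis.
From mathcomp Require Import ring.

Set Implicit Arguments.
Unset Strict Implicit.
Unset Printing Implicit Defensive.

Import Order.TTheory GRing.Theory Num.Theory.
Import numFieldNormedType.Exports.

Local Open Scope classical_set_scope.
Local Open Scope ring_scope.
Local Open Scope quotient_scope.

Section square_summable.
Context {R : realType}.

Definition sqseries (u : nat -> R) : R^nat := series (fun i => u i ^+ 2).

Definition square_summable : {pred (nat -> R)} :=
  [pred u | `[< cvgn (sqseries u) >]].

Lemma square_summableP u : reflect (cvgn (sqseries u)) (u \in square_summable).
Proof. exact: asboolP. Qed.

Lemma nondecreasing_sqseries u : nondecreasing_seq (sqseries u).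
Proof. by apply: nondecreasing_series => n _ _; exact: sqr_ge0. Qed.

Lemma sqseries_le_lim u n : u \in square_summable ->
  sqseries u n <= limn (sqseries u).
Proof.
move=> /square_summableP cu; apply: nondecreasing_cvgn_le => //.
exact: nondecreasing_sqseries.
Qed.

Lemma le_sqseries_cvg u M : (forall n, sqseries u n <= M) ->
  u \in square_summable /\ limn (sqseries u) <= M.
Proof.
move=> uM; have cu : cvgn (sqseries u).
  apply: nondecreasing_is_cvgn; first exact: nondecreasing_sqseries.
  by exists M => _ [n _ <-].
split; first exact/square_summableP.
by apply: limr_le => //; apply: nearW.
Qed.

Lemma sqseriesZ a u n : sqseries (a *: u) n = a ^+ 2 * sqseries u n.
Proof.
rewrite /sqseries /series /= mulr_sumr; apply: eq_bigr => i _.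
by rewrite -exprMn.
Qed.

Lemma sqseriesD u v a b n : 0 < a -> 0 < b ->
  sqseries (u + v) n <= (a + b) * (sqseries u n / a + sqseries v n / b).
Proof.
move=> a0 b0; rewrite /sqseries /series /= !mulr_suml -big_split/= mulr_sumr.
apply: ler_sum => i _; rewrite [(u + v) i]/(u i + v i) -subr_ge0.
have -> : (a + b) * (u i ^+ 2 / a + v i ^+ 2 / b) - (u i + v i) ^+ 2 =
          (b * u i - a * v i) ^+ 2 / (a * b) by field; rewrite !gt_eqF.
by rewrite divr_ge0 ?sqr_ge0// mulr_ge0// ltW.
Qed.

Lemma square_summable_submod_closed : submod_closed square_summable.
Proof.
split.
  apply: (@le_sqseries_cvg _ 0 _).1 => n.
  by rewrite /sqseries /series /= big1// => i _; rewrite expr0n.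
move=> a u v su sv.
apply: (@le_sqseries_cvg _ (2 * (a ^+ 2 * limn (sqseries u) +
                                 limn (sqseries v))) _).1 => n.
apply: (le_trans (sqseriesD _ _ n ltr01 ltr01)).
rewrite !divr1 sqseriesZ -[1 + 1]/(2%:R) ler_wpM2l// lerD ?sqseries_le_lim//.
by rewrite ler_wpM2l ?sqr_ge0// sqseries_le_lim.
Qed.

HB.instance Definition _ :=
  GRing.isSubmodClosed.Build R (nat -> R) square_summable
    square_summable_submod_closed.

End square_summable.

Record ell2 (R : realType) := Ell2 {
  ell2_val :> nat -> R ;
  ell2P : ell2_val \in square_summable }.

Section ell2_normed.
Context {R : realType}.

HB.instance Definition _ := [isSub for @ell2_val R].
HB.instance Definition _ := [Choice of ell2 R by <:].
HB.instance Definition _ := [SubChoice_isSubLmodule of ell2 R by <:].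

Definition ell2_norm (x : ell2 R) : R := Num.sqrt (limn (sqseries x)).

Lemma ell2_norm_ge0 x : 0 <= ell2_norm x.
Proof. exact: sqrtr_ge0. Qed.

Lemma sqr_ell2_norm x : ell2_norm x ^+ 2 = limn (sqseries x).
Proof.
rewrite sqr_sqrtr//; apply: le_trans (sqseries_le_lim 0 (ell2P x)).
by rewrite /sqseries /series /= big_geq.
Qed.

Lemma ell2_norm_eq0 x : ell2_norm x = 0 -> x = 0.
Proof.
move=> x0; apply: val_inj; apply/funext => i /=.
have := sqseries_le_lim i.+1 (ell2P x).
rewrite -sqr_ell2_norm x0 expr0n/= /sqseries /series /= big_nat_recr//=.
move=> h; apply/eqP; rewrite -sqrf_eq0 eq_le sqr_ge0 andbT.
by apply: le_trans h; rewrite lerDr sumr_ge0// => j _; exact: sqr_ge0.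
Qed.

Lemma ell2_normZ (a : R) x : ell2_norm (a *: x) = `|a| * ell2_norm x.
Proof.
rewrite /ell2_norm -sqrtr_sqr -sqrtrM ?sqr_ge0//; congr Num.sqrt.
have -> : sqseries (a *: x : ell2 R) = (fun n => a ^+ 2 * sqseries x n).
  by apply/funext => n; rewrite -sqseriesZ.
apply: cvg_lim; first exact: Rhausdorff.
by apply: cvgMl_tmp; exact/square_summableP/ell2P.
Qed.

Lemma ell2_normD x y : ell2_norm (x + y) <= ell2_norm x + ell2_norm y.
Proof.
have [/ell2_norm_eq0 ->|x0] := eqVneq (ell2_norm x) 0.
  by rewrite add0r lerDr ell2_norm_ge0.
have [/ell2_norm_eq0 ->|y0] := eqVneq (ell2_norm y) 0.
  by rewrite addr0 lerDl ell2_norm_ge0.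
have {}x0 : 0 < ell2_norm x by rewrite lt_neqAle eq_sym x0 ell2_norm_ge0.
have {}y0 : 0 < ell2_norm y by rewrite lt_neqAle eq_sym y0 ell2_norm_ge0.
rewrite -ler_sqr ?nnegrE ?addr_ge0 ?ell2_norm_ge0// sqr_ell2_norm.
apply: (@le_sqseries_cvg _ _ _ _).2 => n.
apply: (le_trans (sqseriesD _ _ n x0 y0)).
rewrite expr2 ler_wpM2l ?addr_ge0 ?ell2_norm_ge0// lerD//.
  by rewrite ler_pdivrMr// -expr2 sqr_ell2_norm sqseries_le_lim ?ell2P.
by rewrite ler_pdivrMr// -expr2 sqr_ell2_norm sqseries_le_lim ?ell2P.
Qed.

HB.instance Definition _ := @Lmodule_isNormed.Build R (ell2 R)
  ell2_norm ell2_normD ell2_normZ ell2_norm_eq0.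

Definition ell2_dist (x y : ell2 R) : R := `|x - y|.

Lemma ell2_dist_ge0 x y : 0 <= ell2_dist x y.
Proof. exact: normr_ge0. Qed.

Lemma ell2_dist_eq0 x y : ell2_dist x y = 0 -> x = y.
Proof. by move/normr0_eq0/eqP; rewrite subr_eq0 => /eqP. Qed.

Lemma ball_ell2E x d : ball x d = [set y | ell2_dist x y < d].
Proof. by rewrite -ball_normE. Qed.

HB.instance Definition _ := PseudoMetric_isMetric.Build R (ell2 R)
  ell2_dist_ge0 ell2_dist_eq0 ball_ell2E.

End ell2_normed.

Section set_type_metric.
Context {R : realType} {X : metricType R} (A : set X).

Definition induced_dist (x y : A) : R := mdist (\val x) (\val y).

Lemma induced_dist_ge0 x y : 0 <= induced_dist x y.
Proof. exact: mdist_ge0. Qed.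

Lemma induced_dist_eq0 x y : induced_dist x y = 0 -> x = y.
Proof. by move/mdist_positivity/val_inj. Qed.

Lemma ball_inducedE (x : A) d : ball x d = [set y | induced_dist x y < d].
Proof. by rewrite -initial_ballE ballEmdist. Qed.

HB.instance Definition _ := PseudoMetric_isMetric.Build R (set_type A)
  induced_dist_ge0 induced_dist_eq0 ball_inducedE.

End set_type_metric.

Definition distance_preserving {R : realType} {X Y : metricType R}
  (f : X -> Y) := forall x y, mdist (f x) (f y) = mdist x y.

(** Only meaningful for bounded non-empty sets: [inf] and [sup] are real-valued
    and return 0 on sets without a real infimum or supremum. *)
Definition hausdorff_dist {R : realType} {X : metricType R} (A B : set X) : R :=
  let dist_to (C : set X) x := inf [set mdist x c | c in C] in
  Num.max (sup [set dist_to B a | a in A]) (sup [set dist_to A b | b in B]).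

(** Only meaningful for compact non-empty spaces [E1] and [E2], as above. *)
Definition gromov_hausdorff_dist {R : realType} (E1 E2 : metricType R) : R :=
  inf [set r | exists (M : metricType R) (phi1 : E1 -> M) (phi2 : E2 -> M),
    [/\ distance_preserving phi1, distance_preserving phi2 &
        r = hausdorff_dist (range phi1) (range phi2)]].

Record compact_ell2 (R : realType) := CompactEll2 {
  compact_set :> set (ell2 R) ;
  compact_set_nonempty : compact_set !=set0 ;
  compact_set_compact : compact compact_set }.

HB.instance Definition _ (R : realType) := gen_eqMixin (compact_ell2 R).
HB.instance Definition _ (R : realType) := gen_choiceMixin (compact_ell2 R).

Section isometry_classes.
Context {R : realType}.

Definition isometric (K1 K2 : compact_ell2 R) : bool :=
  `[< exists J : K1 -> K2, bijective J /\ distance_preserving J >].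

Lemma isometric_refl : reflexive isometric.
Proof. by move=> K; apply/asboolP; exists id; split=> //; exists id. Qed.

Lemma isometricW K1 K2 : isometric K1 K2 -> isometric K2 K1.
Proof.
move=> /asboolP[J [[I JI IJ] dJ]]; apply/asboolP; exists I.
by split; [exists J|move=> x y; rewrite -dJ !IJ].
Qed.

Lemma isometric_sym : symmetric isometric.
Proof. by move=> K1 K2; apply/idP/idP; exact: isometricW. Qed.

Lemma isometric_trans : transitive isometric.
Proof.
move=> K2 K1 K3 /asboolP[J [bJ dJ]] /asboolP[I [bI dI]].
apply/asboolP; exists (I \o J); split; first exact: bij_comp.
by move=> x y /=; rewrite dI dJ.
Qed.

Canonical isometric_equiv :=
  EquivRel isometric isometric_refl isometric_sym isometric_trans.

End isometry_classes.

Definition Hclass (R : realType) := {eq_quot @isometric R}.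

Definition isometry_class {R : realType} (K : compact_ell2 R) : Hclass R :=
  \pi_(Hclass R) K.

Definition dsim {R : realType} (c1 c2 : Hclass R) : R :=
  inf [set r | exists K1 K2 : compact_ell2 R,
    [/\ isometry_class K1 = c1, isometry_class K2 = c2 & r = hausdorff_dist K1 K2]].

(* Main.v *)
(** d_GH <= d_sim, since ell2 itself is an admissible ambient space.

Conversely, if d_GH(L, K) is small, nearby points of L and K in a common space
form a correspondence that almost preserves distances, hence, after translating
a corresponding pair of points to the origin, almost preserves inner products.
Let a_1, ..., a_m be a finite net of K and b_1, ..., b_m corresponding points of
L, and run Gram-Schmidt on both families in parallel, skipping an a_i which
already lies in the span of its predecessors: the coordinates
of corresponding points x and y along the two orthonormal systems are close, and
the part of x orthogonal to the first one is small, so that the same holds for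
y. Recording the coordinates in front and shifting the orthogonal part to the
right is an isometry of ell2 into itself. These two isometries put K and L at
small Hausdorff distance; neither has to be onto, and no isometry
between finite-dimensional subspaces has to be extended. *)

Require Import Defs.
From mathcomp Require Import all_boot all_order all_algebra.
From mathcomp Require Import finmap.
From mathcomp Require Import all_classical all_reals all_analysis.
From mathcomp Require Import ring lra.
Import Order.TTheory GRing.Theory Num.Theory.
Import numFieldNormedType.Exports.
Local Open Scope classical_set_scope.
Local Open Scope ring_scope.

(** * The inner product of [ell2], the right shift, and a single Gram-Schmidt step *)

Section inner_product.
Context {R : realType}.
Implicit Types x y z : ell2 R.

Definition dotp x y : R := limn (series (fun i => x i * y i)).

(** By polarization, each partial sum is a quarter of a difference of two convergent sums of
    squares. *)
Lemma is_cvg_dotp x y : cvgn (series (fun i => x i * y i)).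
Proof.
have -> : series (fun i => x i * y i) =
    (fun n => 4^-1 * (sqseries (x + y : ell2 R) n -
                      sqseries (x - y : ell2 R) n)).
  apply/funext => n; rewrite /sqseries /series /= -sumrB mulr_sumr.
  apply: eq_bigr => i _.
  by rewrite -[RHS]/(4^-1 * ((x i + y i) ^+ 2 - (x i - y i) ^+ 2)); field.
by apply: is_cvgMl_tmp; apply: is_cvgB; exact/square_summableP/ell2P.
Qed.

Lemma dotpC x y : dotp x y = dotp y x.
Proof.
by rewrite /dotp; congr (limn (series _)); apply/funext => i; rewrite mulrC.
Qed.

Lemma dotp_linear a x y z : dotp (a *: x + y) z = a * dotp x z + dotp y z.
Proof.
rewrite /dotp.
have -> : series (fun i => (a *: x + y : ell2 R) i * z i) =
    (fun n => a * series (fun i => x i * z i) n +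
              series (fun i => y i * z i) n).
  apply/funext => n; rewrite /series /= mulr_sumr -big_split/=.
  by apply: eq_bigr => i _; rewrite mulrA -mulrDl.
apply: cvg_lim; first exact: Rhausdorff.
by apply: cvgD; [apply: cvgMl_tmp|]; exact: is_cvg_dotp.
Qed.

Lemma dotpZl a x z : dotp (a *: x) z = a * dotp x z.
Proof.
have h : dotp 0 z = 0.
  by have := dotp_linear 1 0 0 z; rewrite scaler0 addr0 mul1r; lra.
by rewrite -[a *: x]addr0 dotp_linear h addr0.
Qed.

Lemma dotpBl x y z : dotp (x - y) z = dotp x z - dotp y z.
Proof. by rewrite addrC -scaleN1r dotp_linear; ring. Qed.

Lemma dotpBr x y z : dotp z (x - y) = dotp z x - dotp z y.
Proof. by rewrite dotpC dotpBl !(dotpC z). Qed.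

Lemma dotpZr a x z : dotp z (a *: x) = a * dotp z x.
Proof. by rewrite dotpC dotpZl (dotpC z). Qed.

Lemma dotpxx x : dotp x x = `|x| ^+ 2.
Proof. by rewrite [RHS]sqr_ell2_norm. Qed.

Lemma sqr_normB x y : `|x - y| ^+ 2 = `|x| ^+ 2 - 2 * dotp x y + `|y| ^+ 2.
Proof. by rewrite -!dotpxx dotpBl !dotpBr (dotpC y x); ring. Qed.

Lemma dotp_polar x y : dotp x y = (`|x| ^+ 2 + `|y| ^+ 2 - `|x - y| ^+ 2) / 2.
Proof. by rewrite sqr_normB; field. Qed.

Definition cons_seq (t : R) (u : nat -> R) (n : nat) : R :=
  if n is m.+1 then u m else t.

Lemma sqseries_cons t u n :
  sqseries (cons_seq t u) n.+1 = t ^+ 2 + sqseries u n.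
Proof. by rewrite /sqseries /series /= big_nat_recl. Qed.

Lemma cvg_sqseries_cons t x :
  sqseries (cons_seq t x) n @[n --> \oo] --> t ^+ 2 + `|x| ^+ 2.
Proof.
rewrite -(cvg_shiftS (sqseries _)); under eq_fun do rewrite sqseries_cons.
apply: cvgD; first exact: cvg_cst.
by rewrite [X in _ --> X]sqr_ell2_norm; exact/square_summableP/ell2P.
Qed.

Lemma ell2_cons_subproof t x : cons_seq t x \in square_summable.
Proof. by apply/square_summableP/cvg_ex; eexists; exact: cvg_sqseries_cons. Qed.

Definition ell2_cons t x : ell2 R := Ell2 (ell2_cons_subproof t x).

Lemma sqr_norm_cons t x : `|ell2_cons t x| ^+ 2 = t ^+ 2 + `|x| ^+ 2.
Proof.
rewrite [LHS]sqr_ell2_norm; apply: cvg_lim; first exact: Rhausdorff.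
exact: cvg_sqseries_cons.
Qed.

Lemma ell2_consB t u x y :
  ell2_cons t x - ell2_cons u y = ell2_cons (t - u) (x - y).
Proof. by apply/val_inj/funext => -[|n]. Qed.

Lemma sqr_norm_consB t u x y :
  `|ell2_cons t x - ell2_cons u y| ^+ 2 = (t - u) ^+ 2 + `|x - y| ^+ 2.
Proof. by rewrite ell2_consB sqr_norm_cons. Qed.

Definition component a x : R := dotp x a / `|a|.
Definition residual a x : ell2 R := x - (component a x / `|a|) *: a.

Lemma componentB a x y : component a (x - y) = component a x - component a y.
Proof. by rewrite /component dotpBl mulrBl. Qed.

Lemma residualB a x y : residual a (x - y) = residual a x - residual a y.
Proof.
by rewrite /residual componentB mulrBl scalerBl !opprD addrACA.
Qed.

Lemma residual0 a : residual a 0 = 0.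
Proof. by have := residualB a 0 0; rewrite !subrr. Qed.

Lemma residual_self a : residual a a = 0.
Proof.
have [->|a0] := eqVneq a 0; first exact: residual0.
rewrite /residual /component dotpxx.
by rewrite expr2 mulfK ?normr_eq0// divff ?normr_eq0// scale1r subrr.
Qed.

(** Inner products of residuals are thus functions of the original inner products, so closeness of
    the latter can be passed on. *)
Lemma dotp_residual a x y : a != 0 ->
  dotp (residual a x) (residual a y) = dotp x y - component a x * component a y.
Proof.
move=> a0; rewrite /residual dotpBl !dotpBr !dotpZl !dotpZr dotpxx /component.
by rewrite (dotpC a y); field; rewrite normr_eq0.
Qed.

Lemma sqr_norm_residual a x : a != 0 ->
  `|x| ^+ 2 = component a x ^+ 2 + `|residual a x| ^+ 2.
Proof. by move=> a0; rewrite -!dotpxx dotp_residual//; ring. Qed.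

Lemma norm_residual_le a x : a != 0 -> `|residual a x| <= `|x|.
Proof.
move=> a0; rewrite -ler_sqr ?nnegrE//.
by rewrite (sqr_norm_residual a x)// lerDr sqr_ge0.
Qed.

Lemma norm_component_le a x : a != 0 -> `|component a x| <= `|x|.
Proof.
move=> a0; rewrite -ler_sqr ?nnegrE// real_normK ?num_real//.
by rewrite (sqr_norm_residual a x)// lerDl sqr_ge0.
Qed.

End inner_product.

(** * Stability of Gram-Schmidt when inner products are almost preserved *)

Section gram.
Context {R : realType}.

(** Meant for norms [p], [q] of two directions and inner products [u], [v] with them, the quotients
    being coordinates. Squares of norms are compared because they are themselves inner products. *)
Lemma quotient_perturbation (p B e : R) : 0 < p -> 0 <= B -> 0 < e ->
  exists2 d, 0 < d & forall q u v, 0 <= q -> `|p ^+ 2 - q ^+ 2| <= d ->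
    `|u - v| <= d -> `|u / p| <= B -> 0 < q /\ `|u / p - v / q| <= e.
Proof.
move=> p0 B0 e0; pose L := 2 / p + 2 * B / p ^+ 2.
have L0 : 0 < L by rewrite ltr_pwDl ?divr_gt0// divr_ge0 ?sqr_ge0// mulr_ge0.
(* The first bound forces [q >= p / 2]; the error is then at most [L] times the second. *)
exists (Num.min (3 / 4 * p ^+ 2) (e / L)).
  by rewrite lt_min divr_gt0// andbT mulr_gt0 ?exprn_gt0.
move=> q u v q0; rewrite !le_min => /andP[pq pqL] /andP[_ uvL] upB.
have qp : p / 2 <= q.
  have pge0 := ltW p0; rewrite -ler_sqr ?nnegrE ?divr_ge0//.
  move: pq; rewrite ler_norml => /andP[_] h.
  have -> : (p / 2) ^+ 2 = p ^+ 2 / 4 by field.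
  by lra.
have {}q0 : 0 < q by rewrite (lt_le_trans _ qp)// divr_gt0.
split=> //; move: pqL uvL; set d := e / L => pqL uvL.
have d0 : 0 <= d by rewrite divr_ge0// ltW.
have -> : u / p - v / q =
    (u - v) / q + (u / p) * ((q ^+ 2 - p ^+ 2) / ((p + q) * q)).
  by field; rewrite !gt_eqF ?addr_gt0.
have -> : e = d / (p / 2) + B * (d / (p * (p / 2))).
  have -> : e = d * L by rewrite divfK// gt_eqF.
  by rewrite /L; field; rewrite gt_eqF.
rewrite (le_trans (ler_normD _ _))// lerD//.
  rewrite normrM normfV (gtr0_norm q0) ler_pM ?invr_ge0 ?(ltW q0)//.
  by rewrite lef_pV2 ?posrE ?divr_gt0.
rewrite normrM ler_pM// normrM normfV distrC.
have h : 0 < (p + q) * q by rewrite mulr_gt0 ?addr_gt0.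
rewrite (gtr0_norm h) ler_pM ?invr_ge0 ?(ltW h)//.
rewrite lef_pV2 ?posrE ?mulr_gt0 ?addr_gt0 ?divr_gt0//.
by rewrite ler_pM ?(ltW p0) ?divr_ge0 ?(ltW p0)// lerDl (ltW q0).
Qed.

Implicit Types (a b x y : ell2 R) (rel : ell2 R -> ell2 R -> Prop).

Definition gram_close (d : R) rel := forall x y x' y', rel x y -> rel x' y' ->
  `|dotp x x' - dotp y y'| <= d.

Definition isometric_map (U : ell2 R -> ell2 R) :=
  forall x y, `|U x - U y| = `|x - y|.

(** Pythagoras: the coordinate along [a] and the residual together carry the whole distance. *)
Lemma isometric_map_cons a (U : ell2 R -> ell2 R) : a != 0 ->
  isometric_map U ->
  isometric_map (fun x => ell2_cons (component a x) (U (residual a x))).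
Proof.
move=> a0 iU x y; apply/eqP; rewrite -(@eqrXn2 _ 2)//.
by rewrite /= sqr_norm_consB iU -(componentB a x y) -residualB
  -sqr_norm_residual.
Qed.

Definition residual_rel a b rel x' y' :=
  exists x y, [/\ rel x y, x' = residual a x & y' = residual b y].

(** The tolerance [d] is fixed before [rel] and [b], so that it can later serve all sets near [K] at
    once. *)
Lemma gram_close_residual a (B e : R) : a != 0 -> 0 <= B -> 0 < e ->
  exists2 d, 0 < d & forall rel b, (forall x y, rel x y -> `|x| <= B) ->
    rel a b -> gram_close d rel ->
    [/\ b != 0, forall x y, rel x y -> `|component a x - component b y| <= e &
        gram_close e (residual_rel a b rel)].
Proof.
move=> a0 B0 e0.
(* With coordinates [t]-close and [t <= 1], [|v| <= B + 1], so the products [u * u'] and [v * v']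
   differ by at most [(2 * B + 1) * t <= e / 2]. *)
pose t := Num.min 1 (Num.min e (e / (2 * (2 * B + 1)))).
have t0 : 0 < t.
  by rewrite !lt_min ltr01 e0/= divr_gt0// mulr_gt0// ltr_wpDl// mulr_ge0.
have na0 : 0 < `|a| by rewrite normr_gt0.
have [d d0 dP] := @quotient_perturbation `|a| B t na0 B0 t0.
exists (Num.min d (e / 2)); first by rewrite lt_min d0 divr_gt0.
move=> rel b relB ab gc.
have hd x y x' y' : rel x y -> rel x' y' -> `|dotp x x' - dotp y y'| <= d.
  by move=> r r'; apply: le_trans (gc _ _ _ _ r r') _; rewrite ge_min lexx.
have cB x y : rel x y -> `|component a x| <= B.
  by move=> /relB; apply: le_trans; exact: norm_component_le.
have hq x y : rel x y -> 0 < `|b| /\ `|component a x - component b y| <= t.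
  move=> r; apply: dP => //; [by rewrite -!dotpxx hd|exact: hd|exact: cB r].
have b0 : b != 0 by rewrite -normr_gt0; exact: (hq _ _ ab).1.
split=> //.
  by move=> x y /hq[_ /le_trans]; apply; rewrite !ge_min lexx orbT.
move=> _ _ _ _ [x [y [r -> ->]]] [x' [y' [r' -> ->]]].
rewrite !dotp_residual//.
have := gc _ _ _ _ r r'; rewrite le_min => /andP[_ h].
have := (hq _ _ r).2; have := (hq _ _ r').2.
move: (cB _ _ r) (cB _ _ r').
move: (component a x) (component a x') (component b y) (component b y').
move=> u u' v v' uB u'B uv' uv.
have -> : dotp x x' - u * u' - (dotp y y' - v * v') =
  (dotp x x' - dotp y y') - ((u - v) * u' + v * (u' - v')) by ring.
rewrite (le_trans (ler_normB _ _))//.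
rewrite [leRHS]splitr lerD//.
have -> : e / 2 =
    (e / (2 * (2 * B + 1))) * B + (B + 1) * (e / (2 * (2 * B + 1))).
  by field; rewrite gt_eqF// ltr_wpDl// mulr_ge0.
have te : t <= e / (2 * (2 * B + 1)) by rewrite !ge_min lexx !orbT.
have t1 : t <= 1 by rewrite ge_min lexx.
rewrite (le_trans (ler_normD _ _))// !normrM lerD// ler_pM//.
- exact: le_trans te.
- have -> : v = u - (u - v) by ring.
  rewrite (le_trans (ler_normB _ _))// lerD//; exact: le_trans t1.
- exact: le_trans te.
Qed.

Lemma sqr_normB_le x y : `|x - y| ^+ 2 <= 2 * `|x| ^+ 2 + 2 * `|y| ^+ 2.
Proof.
have := sqr_ge0 (`|x| - `|y|); rewrite sqrrB => h.
have : `|x - y| ^+ 2 <= (`|x| + `|y|) ^+ 2.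
  by rewrite ler_sqr ?nnegrE ?addr_ge0// ler_normB.
rewrite sqrrD; lra.
Qed.

(* [0] joins [s] for the sake of the base case: once the directions in [s] have
   been split off, the norm of what remains of [x] is its distance to their
   span, hence at most its distance to any point of [s]. *)
Definition alignable (s : seq (ell2 R)) (B e d : R) := forall rel,
  (forall x y, rel x y -> `|x| <= B) ->
  (forall a, a \in s -> exists b, rel a b) -> gram_close d rel ->
  exists U W, [/\ isometric_map U, isometric_map W &
    forall x y p, rel x y -> p \in 0 :: s ->
      `|U x - W y| ^+ 2 <= 4 * `|x - p| ^+ 2 + e].

(** Only [p = 0] occurs, and [|y| ^+ 2 <= |x| ^+ 2 + e / 2]; inserting this in
    [2 * |x| ^+ 2 + 2 * |y| ^+ 2] produces the factor 4. *)
Lemma alignable_nil (B e : R) : alignable [::] B e (e / 2).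
Proof.
move=> rel _ _ gc; exists id, id; split=> // x y p r.
rewrite inE => /eqP ->; rewrite subr0 (le_trans (sqr_normB_le _ _))//.
have := gc _ _ _ _ r r; rewrite !dotpxx ler_norml => /andP[h _].
by rewrite -subr_ge0; lra.
Qed.

Lemma exists_alignable (s : seq (ell2 R)) (B e : R) : 0 <= B -> 0 < e ->
  exists2 d, 0 < d & alignable s B e d.
Proof.
(* The induction is on length, since the next list consists of residuals and is not the tail
   itself. *)
move: {2}(size s) (leqnn (size s)) => n.
elim: n s B e => [|n IH] [|a s] B e sn B0 e0 //;
  try by exists (e / 2); [exact: divr_gt0|exact: alignable_nil].
(* A vanishing [a] adds no direction; as a target [p] it is covered by the leading 0. *)
have [->|a0] := eqVneq a 0.
  have [d d0 dP] := IH s B e sn B0 e0; exists d => // rel relB rels gc.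
  have [|U [W [iU iW UW]]] := dP rel relB _ gc.
    by move=> b bs; apply: rels; rewrite inE bs orbT.
  exists U, W; split=> // x y p r; rewrite inE => /orP[/eqP->|].
    by apply: UW; rewrite ?inE ?eqxx.
  exact: UW.
have e20 : 0 < e / 2 by rewrite divr_gt0.
have [|d1 d10 dP1] := IH [seq residual a x | x <- s] B (e / 2) _ B0 e20.
  by rewrite size_map.
(* [d1] feeds the recursive call; the rest makes the squared coordinate error at most
   [t ^+ 2 <= t <= e / 2]. *)
pose t := Num.min d1 (Num.min 1 (e / 2)).
have t0 : 0 < t by rewrite !lt_min d10 ltr01 e20.
have [d d0 dP] := gram_close_residual _ _ _ a0 B0 t0.
exists d => // rel relB rels gc.
have [b ab] : exists b, rel a b by apply: rels; rewrite inE eqxx.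
have [b0 compab gcr] := dP _ _ relB ab gc.
have [|||U [W [iU iW UW]]] := dP1 (residual_rel a b rel).
- move=> _ _ [x [y [/relB xB -> _]]].
  by rewrite (le_trans _ xB)// norm_residual_le.
- move=> _ /mapP[x xs ->]; have [|y xy] := rels x; first by rewrite inE xs orbT.
  by exists (residual b y); exists x, y.
- move=> x y x' y' r r'; apply: le_trans (gcr _ _ _ _ r r') _.
  by rewrite ge_min lexx.
exists (fun x => ell2_cons (component a x) (U (residual a x))).
exists (fun y => ell2_cons (component b y) (W (residual b y))).
split; [exact: isometric_map_cons..|] => x y p r ps.
(* The target [a] itself becomes 0, which is still an allowed target. *)
have rp : residual a p \in 0 :: [seq residual a x | x <- s].
  move: ps; rewrite !inE => /orP[/eqP->|/orP[/eqP->|ps]].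
  - by rewrite residual0 eqxx.
  - by rewrite residual_self eqxx.
  - by rewrite map_f ?orbT.
rewrite sqr_norm_consB [e]splitr addrA [leLHS]addrC; apply: lerD.
  rewrite (le_trans (UW _ _ _ _ rp))//; first by exists x, y.
  rewrite lerD2r ler_pM2l// -residualB ler_sqr ?nnegrE//.
  exact: norm_residual_le.
have := compab _ _ r; rewrite le_min le_min => /and3P[_ c1 c2].
rewrite -real_normK ?num_real// expr2 (le_trans _ c2)//.
by rewrite ler_piMr.
Qed.

End gram.

(** * The Hausdorff distance in a metric space *)

Section hausdorff.
Context {R : realType} {X : metricType R}.
Implicit Types A B : set X.

Lemma inf_mdist_ge0 A x : 0 <= inf [set mdist x a | a in A].
Proof.
have [->|/set0P[a Aa]] := eqVneq A set0; first by rewrite image_set0 inf0.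
by apply: lb_le_inf => [|_ [b _ <-]]; [exists (mdist x a), a|exact: mdist_ge0].
Qed.

Lemma inf_mdist_le A x a : A a -> inf [set mdist x a | a in A] <= mdist x a.
Proof.
move=> Aa; apply: ge_inf; last by exists a.
by exists 0 => _ [b _ <-]; exact: mdist_ge0.
Qed.

Lemma hausdorff_distC A B : hausdorff_dist A B = hausdorff_dist B A.
Proof. exact: maxC. Qed.

Lemma hausdorff_dist_ge0 A B : 0 <= hausdorff_dist A B.
Proof.
rewrite le_max; apply/orP; left; set S := [set _ | _ in _].
(* Without a real supremum, [sup] takes its default value 0. *)
have [hS|/sup_out ->//] := pselect (has_sup S).
have [_ [a Aa _]] := hS.1; apply: le_trans (inf_mdist_ge0 B a) _.
by apply: ub_le_sup; [exact: hS.2|exists a].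
Qed.

Lemma hausdorff_dist_le A B e : A !=set0 -> B !=set0 ->
  (forall a, A a -> exists2 b, B b & mdist a b <= e) ->
  (forall b, B b -> exists2 a, A a & mdist b a <= e) ->
  hausdorff_dist A B <= e.
Proof.
move=> [a0 Aa0] [b0 Bb0] AB BA; rewrite ge_max; apply/andP; split.
  apply: ge_sup; first by eexists; exists a0.
  move=> _ [a /AB[b Bb ab] <-]; apply: le_trans ab; exact: inf_mdist_le.
apply: ge_sup; first by eexists; exists b0.
move=> _ [b /BA[a Aa ba] <-]; apply: le_trans ba; exact: inf_mdist_le.
Qed.

(** The bound [D] makes the supremum a genuine one, so that it dominates each point's distance to
    [B]. *)
Lemma hausdorff_dist_lt A B D e : (forall a b, A a -> B b -> mdist a b <= D) ->
  B !=set0 -> hausdorff_dist A B < e ->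
  forall a, A a -> exists2 b, B b & mdist a b < e.
Proof.
move=> ABD [b0 Bb0]; rewrite gt_max => /andP[supe _] a Aa.
have : inf [set mdist a b | b in B] < e.
  apply: le_lt_trans supe; apply: ub_le_sup; last by exists a.
  exists D => _ [c Ac <-]; apply: le_trans (ABD _ _ Ac Bb0).
  exact: inf_mdist_le.
move/inf_lt => [|_ [b Bb <-] abe]; first by exists (mdist a b0), b0.
by exists b.
Qed.

End hausdorff.

Lemma distance_preserving_continuous {R : realType} (X Y : metricType R)
    (f : X -> Y) :
  distance_preserving f -> continuous f.
Proof.
move=> df x A /nbhs_ballP[e e0 eA]; apply/nbhs_ballP; exists e => // y xy.
by apply: eA; move: xy; rewrite !ballEmdist/= df.
Qed.

(** For the polarization formula; the constant 3/2 is rounded up to 2. *)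
Lemma half_sum_close {R : realFieldType} (a b c a' b' c' t : R) :
  `|a - a'| <= t -> `|b - b'| <= t -> `|c - c'| <= t ->
  `|(a + b - c) / 2 - (a' + b' - c') / 2| <= 2 * t.
Proof.
rewrite !ler_norml => /andP[a1 a2] /andP[b1 b2] /andP[c1 c2].
by apply/andP; split; lra.
Qed.

(** * Compact subsets of [ell2], and the comparison of the two distances *)

Section ell2_compact.
Context {R : realType}.
Implicit Types (K L : compact_ell2 R) (x y : ell2 R).

Lemma compact_ell2_bounded K :
  exists2 M, 0 <= M & forall x, compact_set K x -> `|x| <= M.
Proof.
have [M [_ MP]] := compact_bounded (@compact_set_compact _ K).
exists (`|M| + 1) => // x Kx; apply: (MP (`|M| + 1)) => //.
by rewrite ltr_pwDr// ler_norm.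
Qed.

Lemma compact_ell2_net K e : 0 < e -> exists s : seq (ell2 R),
  (forall p, p \in s -> compact_set K p) /\
  forall x, compact_set K x -> exists2 p, p \in s & `|x - p| < e.
Proof.
move=> e0; have := @compact_set_compact _ K; rewrite compact_cover.
move=> /(_ _ (compact_set K) (fun p => ball p e))[||D DK KD].
- by move=> p _; exact: ball_open.
- by move=> x Kx; exists x => //; exact: ballxx.
exists (enum_fset D); split=> [p pD|x /KD[p pD]].
  by have := DK _ pD; rewrite inE.
by rewrite -ball_normE/= distrC => xp; exists p.
Qed.

Lemma image_compact_subproof {U : ell2 R -> ell2 R} (iU : isometric_map U) K :
  U @` compact_set K !=set0 /\ compact (U @` compact_set K).
Proof.
split; first by have [x Kx] := compact_set_nonempty K; exists (U x), x.
apply: continuous_compact; last exact: compact_set_compact.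
apply/continuous_subspaceT.
exact: (@distance_preserving_continuous _ (ell2 R) (ell2 R)).
Qed.

Definition image_compact {U : ell2 R -> ell2 R} (iU : isometric_map U) K :=
  CompactEll2 (image_compact_subproof iU K).1 (image_compact_subproof iU K).2.

Lemma isometry_class_image {U : ell2 R -> ell2 R} (iU : isometric_map U) K :
  isometry_class (image_compact iU K) = isometry_class K.
Proof.
apply/esym/eqmodP/asboolP.
have UK (x : K) : U (val x) \in (image_compact iU K : set _).
  by apply/mem_set; exists (val x) => //; exact: set_valP.
have /choice[V UV] : forall y : image_compact iU K,
    exists x : K, U (val x) = val y.
  move=> y; have [x Kx xy] := set_valP y.
  by exists (SigSub (mem_set Kx)).
pose J (z : K) : image_compact iU K := SigSub (UK z).
exists J; split; last by move=> x y; exact: iU.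
exists V => [x|y]; last by apply: val_inj; rewrite /= UV.
apply/val_inj/eqP; rewrite -subr_eq0 -normr_eq0 -iU UV/=.
by rewrite subrr normr0.
Qed.

Lemma dsim_ge0 (c1 c2 : Hclass R) : 0 <= dsim c1 c2.
Proof.
rewrite /dsim; set S := [set r | _].
have [->|/set0P S0] := eqVneq S set0; first by rewrite inf0.
by apply: lb_le_inf => // _ [K1 [K2 [_ _ ->]]]; exact: hausdorff_dist_ge0.
Qed.

Lemma dsim_le_hausdorff K L :
  dsim (isometry_class K) (isometry_class L) <=
  hausdorff_dist (compact_set K) (compact_set L).
Proof.
apply: ge_inf; last by exists K, L.
by exists 0 => _ [K1 [K2 [_ _ ->]]]; exact: hausdorff_dist_ge0.
Qed.

Lemma gromov_hausdorff_dist_ge0 (E1 E2 : metricType R) :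
  0 <= gromov_hausdorff_dist E1 E2.
Proof.
rewrite /gromov_hausdorff_dist; set S := [set r | _].
have [->|/set0P S0] := eqVneq S set0; first by rewrite inf0.
by apply: lb_le_inf => // _ [M [f [g [_ _ ->]]]]; exact: hausdorff_dist_ge0.
Qed.

Lemma isometry_class_embedding K L : isometry_class K = isometry_class L ->
  exists2 f : (L : set (ell2 R)) -> ell2 R,
    distance_preserving f & range f = compact_set K.
Proof.
move=> /esym/eqmodP/asboolP[J [[I JI IJ] dJ]].
exists (fun z => val (J z)); first by move=> x y; exact: (dJ x y).
apply/seteqP; split => [_ [x _ <-]|x Kx]; first exact: set_valP.
by exists (I (SigSub (mem_set Kx))); rewrite ?IJ.
Qed.

Lemma gromov_hausdorff_dist_le_dsim K L :
  gromov_hausdorff_dist (K : set (ell2 R)) (L : set (ell2 R)) <=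
  dsim (isometry_class K) (isometry_class L).
Proof.
apply: lb_le_inf; first by eexists; exists K, L.
move=> _ [K1 [L1 [/isometry_class_embedding[f df fK]
  /isometry_class_embedding[g dg gL] ->]]].
apply: ge_inf; last by exists (ell2 R), f, g; rewrite fK gL.
by exists 0 => _ [M [? [? [_ _ ->]]]]; exact: hausdorff_dist_ge0.
Qed.

(** Points are related when their images in a common space are less than [e] apart. *)
Lemma correspondence_gromov_hausdorff K L (e : R) :
  gromov_hausdorff_dist (K : set (ell2 R)) (L : set (ell2 R)) < e ->
  exists rel : ell2 R -> ell2 R -> Prop,
    [/\ forall x y, rel x y -> compact_set L x /\ compact_set K y,
        forall x, compact_set L x -> exists y, rel x y,
        forall y, compact_set K y -> exists x, rel x y &
        forall x y x' y', rel x y -> rel x' y' ->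
          `| `|x - x'| - `|y - y'| | <= 2 * e].
Proof.
move=> /inf_lt[|_ [M [f [g [df dg ->]]]] fge].
  by eexists; exists (ell2 R), val, val.
have [B B0 KB] := compact_ell2_bounded K.
have [C C0 LC] := compact_ell2_bounded L.
have [y0 Ky0] := compact_set_nonempty K.
have [x0 Lx0] := compact_set_nonempty L.
pose ys : (K : set (ell2 R)) := SigSub (mem_set Ky0).
pose xs : (L : set (ell2 R)) := SigSub (mem_set Lx0).
(* Two diameter bounds and one fixed distance give the [D] of [hausdorff_dist_lt]. *)
have fgD a b : range f a -> range g b ->
    mdist a b <= 2 * B + (mdist (f ys) (g xs) + 2 * C).
  move=> [y _ <-] [x _ <-].
  apply: le_trans (metric_triangle _ (f ys) _) _; apply: lerD.
    rewrite df; apply: le_trans (ler_normB _ _) _.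
    by rewrite mulr2n mulrDl !mul1r lerD// KB//; exact: set_valP.
  apply: le_trans (metric_triangle _ (g xs) _) _; apply: lerD => //.
  rewrite dg; apply: le_trans (ler_normB _ _) _.
  by rewrite mulr2n mulrDl !mul1r lerD// LC//; exact: set_valP.
exists (fun x y => exists (u : (L : set (ell2 R))) (v : (K : set (ell2 R))),
  [/\ x = val u, y = val v & mdist (f v) (g u) < e]); split.
- by move=> _ _ [u [v [-> -> _]]]; split; exact: set_valP.
- move=> x Lx; pose u : (L : set (ell2 R)) := SigSub (mem_set Lx).
  have [||||_ [v _ <-] vu] := @hausdorff_dist_lt _ _ (range g) (range f)
    (2 * B + (mdist (f ys) (g xs) + 2 * C)) e _ _ _ (g u).
  + by move=> a b ga fb; rewrite metric_sym; exact: fgD.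
  + by exists (f ys), ys.
  + by rewrite hausdorff_distC.
  + by exists u.
  by exists (val v), u, v; split=> //; rewrite metric_sym.
- move=> y Ky; pose v : (K : set (ell2 R)) := SigSub (mem_set Ky).
  have [||_ [u _ <-] vu] := hausdorff_dist_lt _ _ _ _ fgD _ fge (f v).
  + by exists (g xs), xs.
  + by exists v.
  by exists (val u), u, v.
move=> _ _ _ _ [u [v [-> -> uv]]] [u' [v' [-> -> uv']]].
rewrite -[ `|val u - val u'|]/(mdist u u') -[ `|val v - val v'|]/(mdist v v').
rewrite -df -dg.
(* In the quadrilateral [f v], [g u], [g u'], [f v'] two opposite sides are below [e], so the other
   two differ by at most [2 * e]. *)
have h1 := metric_triangle (g u) (f v) (g u').
have h2 := metric_triangle (f v) (f v') (g u').
have h3 := metric_triangle (f v) (g u) (f v').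
have h4 := metric_triangle (g u) (g u') (f v').
rewrite (metric_sym (g u) (f v)) in h1.
rewrite (metric_sym (g u') (f v')) in h4.
by rewrite ler_norml; apply/andP; split; lra.
Qed.

Lemma gram_close_translate (rel : ell2 R -> ell2 R -> Prop) x0 y0 (B t : R) :
  rel x0 y0 -> (forall x y, rel x y -> `|x - x0| <= B) -> 0 <= t <= 1 ->
  (forall x y x' y', rel x y -> rel x' y' ->
     `| `|x - x'| - `|y - y'| | <= t) ->
  gram_close (2 * (4 * B + 1) * t)
    (fun u v => exists x y, [/\ rel x y, u = x - x0 & v = y - y0]).
Proof.
move=> r0 relB /andP[t0 t1] dis.
have sq x y x' y' : rel x y -> rel x' y' ->
    `| `|x - x'| ^+ 2 - `|y - y'| ^+ 2| <= (4 * B + 1) * t.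
  move=> r r'; have := dis _ _ _ _ r r'.
  have : `|x - x'| <= 2 * B.
    have -> : x - x' = (x - x0) - (x' - x0) by rewrite opprB addrA subrK.
    apply: le_trans (ler_normB _ _) _.
    by rewrite mulr2n mulrDl !mul1r; apply: lerD; [exact: relB r|exact: relB r'].
  move: (normr_ge0 (x - x')) (normr_ge0 (y - y')).
  move: `|x - x'| `|y - y'| => p q p0 q0 pB pq.
  (* Here [p <= 2 * B] and [q <= p + t <= 2 * B + 1], whence the factor [4 * B + 1]. *)
  rewrite subr_sqr normrM mulrC ler_pM// ger0_norm ?addr_ge0//.
  by move: pq; rewrite ler_norml => /andP[]; lra.
move=> _ _ _ _ [x [y [r -> ->]]] [x' [y' [r' -> ->]]].
rewrite !dotp_polar.
have -> : x - x0 - (x' - x0) = x - x' by rewrite opprB addrA subrK.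
have -> : y - y0 - (y' - y0) = y - y' by rewrite opprB addrA subrK.
rewrite -mulrA.
exact: half_sum_close (sq _ _ _ _ r r0) (sq _ _ _ _ r' r0) (sq _ _ _ _ r r').
Qed.

(** The net and the directions come from [K] alone, which makes [d] uniform in [L]. *)
Lemma dsim_small K (e : R) : 0 < e -> exists2 d, 0 < d & forall L,
  gromov_hausdorff_dist (L : set (ell2 R)) (K : set (ell2 R)) < d ->
  dsim (isometry_class L) (isometry_class K) <= e.
Proof.
move=> e0.
have [x0 Kx0] := compact_set_nonempty K.
have [M M0 KM] := compact_ell2_bounded K.
have B0 : 0 <= 2 * M by rewrite mulr_ge0.
have e40 : 0 < e / 4 by rewrite divr_gt0.
(* Mesh [e / 4] and error [e ^+ 2 / 2] add up to [4 * (e / 4) ^+ 2 + e ^+ 2 / 2 <= e ^+ 2]. *)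
have [s [sK Ks]] := compact_ell2_net K _ e40.
have h0 : 0 < e ^+ 2 / 2 by rewrite divr_gt0 ?exprn_gt0.
have [d d0 dP] := exists_alignable [seq p - x0 | p <- s] _ _ B0 h0.
have C0 : 0 < 2 * (4 * (2 * M) + 1) by lra.
(* Distortion [t] changes inner products by at most [2 * (4 * (2 * M) + 1) * t <= d]; a
   Gromov-Hausdorff distance below [t / 2] ensures it. *)
pose t := Num.min 1 (d / (2 * (4 * (2 * M) + 1))).
have t0 : 0 < t by rewrite lt_min ltr01 divr_gt0.
exists (t / 2); first by rewrite divr_gt0.
move=> L /correspondence_gromov_hausdorff[rel [relKL relK relL]].
have -> : 2 * (t / 2) = t by field.
move=> dis.
have [y0 r0] := relK _ Kx0.
have relB x y : rel x y -> `|x - x0| <= 2 * M.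
  move=> /relKL[Kx _]; apply: le_trans (ler_normB _ _) _.
  by rewrite mulr2n mulrDl !mul1r lerD// KM.
have t01 : 0 <= t <= 1 by rewrite ltW//= ge_min lexx.
have gc := gram_close_translate _ _ _ _ _ r0 relB t01 dis.
have [|||U [W [iU iW UW]]] := dP (fun u v =>
  exists x y, [/\ rel x y, u = x - x0 & v = y - y0]).
- by move=> _ _ [x [y [/relB + -> _]]].
- move=> _ /mapP[p /sK/relK[y r] ->]; exists (y - y0); by exists p, y.
- move=> u v u' v' r r'; apply: le_trans (gc _ _ _ _ r r') _.
  by rewrite mulrC -ler_pdivlMr// ge_min lexx orbT.
have iU' : isometric_map (fun x => U (x - x0)).
  by move=> x y; rewrite iU opprB addrA subrK.
have iW' : isometric_map (fun y => W (y - y0)).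
  by move=> x y; rewrite iW opprB addrA subrK.
have UWe x y : rel x y -> `|U (x - x0) - W (y - y0)| <= e.
  move=> r; have [p ps xp] := Ks _ (relKL _ _ r).1.
  rewrite -ler_sqr ?nnegrE ?(ltW e0)//.
  have ps' : p - x0 \in 0 :: [seq p - x0 | p <- s].
    by rewrite inE (map_f (fun p => p - x0) ps) orbT.
  have := UW (x - x0) (y - y0) (p - x0).
  have -> : x - x0 - (p - x0) = x - p by rewrite opprB addrA subrK.
  move=> h; apply: le_trans (h _ ps') _; first by exists x, y.
  have : `|x - p| ^+ 2 <= (e / 4) ^+ 2.
    by rewrite ler_sqr ?nnegrE ?(ltW xp)// ltW.
  have -> : (e / 4) ^+ 2 = e ^+ 2 / 16 by field.
  by have := sqr_ge0 e; lra.
(* The classes are represented by the aligned copies, with the translations absorbed into the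
   isometries. *)
rewrite -(isometry_class_image iW' L) -(isometry_class_image iU' K).
apply: le_trans (dsim_le_hausdorff _ _) _.
apply: hausdorff_dist_le; [exact: compact_set_nonempty..| |].
  move=> _ [y /relL[x r] <-]; exists (U (x - x0)).
    by exists x => //; exact: (relKL _ _ r).1.
  by rewrite /mdist/= /ell2_dist distrC UWe.
move=> _ [x /relK[y r] <-]; exists (W (y - y0)).
  by exists y => //; exact: (relKL _ _ r).2.
exact: UWe.
Qed.

End ell2_compact.

Theorem theorem2p12 (R : realType) (Kn : nat -> compact_ell2 R)
    (K : compact_ell2 R) :
  dsim (isometry_class (Kn n)) (isometry_class K) @[n --> \oo] --> (0 : R) <->
  gromov_hausdorff_dist (Kn n : set (ell2 R)) (K : set (ell2 R)) @[n --> \oo]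
    --> (0 : R).
Proof.
split=> [h|h].
  apply: (squeeze_cvgr _ (cvg_cst 0) h); apply: nearW => n.
  by rewrite gromov_hausdorff_dist_ge0 gromov_hausdorff_dist_le_dsim.
apply/cvgr0Pnorm_le => e e0; have [d d0 dP] := dsim_small K _ e0.
move/cvgr0Pnorm_lt : h => /(_ _ d0); apply: filterS => n.
rewrite !ger0_norm ?dsim_ge0 ?gromov_hausdorff_dist_ge0//; exact: dP.
Qed.
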